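(* Let $n,p$ be positive integers, let $\Phi\in\mathbb{C}^{p\times p}$ be unitary, and let $\mathcal{A},\mathcal{B}\in\mathbb{C}^{n\times n\times p}$ be $\Phi$-Hermitian. Then $$\operatorname{Tr}_{\Phi}\bigl(\exp_{\Phi}(\mathcal{A}\oplus_{\Phi}\mathcal{B})\bigr)\le \operatorname{Tr}_{\Phi}\bigl(\exp_{\Phi}(\mathcal{A})\star_{\Phi}\exp_{\Phi}(\mathcal{B})\bigr).$$
   Context: For a tensor $\mathcal{X}\in\mathbb{C}^{n_1\times n_2\times p}$ with frontal slices $\mathcal{X}^{(k)}\in\mathbb{C}^{n_1\times n_2}$ ($k=1,\dots,p$) and a unitary $\Phi\in\mathbb{C}^{p\times p}$, the transformed slices are $\hat{\mathcal{X}}_{\Phi}^{(\omega)}=\sum_{k=1}^p\Phi_{\omega k}\mathcal{X}^{(k)}$, $\omega=1,\dots,p$, and the lifting is $\overline{\mathcal{X}}_{\Phi}=\operatorname{blockdiag}(\hat{\mathcal{X}}_{\Phi}^{(1)},\dots,\hat{\mathcal{X}}_{\Phi}^{(p)})\in\mathbb{C}^{pn_1\times pn_2}$. Since $\Phi$ is invertible, a tensor is determined by its lifting. The $\Phi$-product $\mathcal{A}\star_\Phi\mathcal{B}$ is the tensor whose lifting is $\overline{\mathcal{A}}_{\Phi}\overline{\mathcal{B}}_{\Phi}$. The $\Phi$-sum $\mathcal{A}\oplus_{\Phi}\mathcal{B}$ is the tensor whose lifting is $\overline{\mathcal{A}}_{\Phi}+\overline{\mathcal{B}}_{\Phi}$.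 The $\Phi$-trace is $\operatorname{Tr}_\Phi(\mathcal{A})=\operatorname{Tr}(\overline{\mathcal{A}}_{\Phi})$. The $\Phi$-exponential $\exp_\Phi(\mathcal{A})$ is the tensor whose lifting is the matrix exponential $\exp(\overline{\mathcal{A}}_{\Phi})$. A tensor $\mathcal{A}\in\mathbb{C}^{n\times n\times p}$ is $\Phi$-Hermitian if $\overline{\mathcal{A}}_{\Phi}$ is Hermitian, equivalently every $\hat{\mathcal{A}}_{\Phi}^{(\omega)}$ is Hermitian. *)

(* Defs.v *)
From HB Require Import structures.
From mathcomp Require Import all_boot all_order all_algebra.
From mathcomp Require Import complex.
From mathcomp Require Import boolp classical_sets filter reals.
From mathcomp Require Import topology normedtype sequences.

Set Implicit Arguments.
Unset Strict Implicit.
Unset Printing Implicit Defensive.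

Import Order.TTheory GRing.Theory Num.Theory.
Import numFieldNormedType.Exports.

Local Open Scope classical_set_scope.
Local Open Scope ring_scope.

(* The series converges for every M when K = R[i] with R : realType; over an
   incomplete K the limit may be a default value. *)
Definition expmx (K : numFieldType) (m : nat) (M : 'M[K]_m) : 'M[K]_m :=
  limn (series (fun k => (k`!%:R)^-1 *: M ^+ k)).

Section PhiCalculus.
Variables (C : numClosedFieldType) (n p : nat).

(* A tensor of size n x n x p is the family of its p frontal slices. *)
Definition tensor := {ffun 'I_p -> 'M[C]_n}.

Implicit Types (Phi : 'M[C]_p) (X Y : tensor) (w k : 'I_p).

Definition phi_slice Phi X w : 'M[C]_n := \sum_(k < p) Phi w k *: X k.

Definition phi_lift Phi X : 'M[C]_(\sum_(w < p) n) :=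
  \mxdiag_(w < p) phi_slice Phi X w.

(* When Phi is invertible and M is block diagonal, this is the unique tensor
   whose lifting is M: see phi_liftK and phi_unliftK. *)
Definition phi_unlift Phi (M : 'M[C]_(\sum_(w < p) n)) : tensor :=
  [ffun k => \sum_(w < p) invmx Phi k w *: submxblock M w w].

Definition phi_mul Phi X Y : tensor :=
  phi_unlift Phi (phi_lift Phi X *m phi_lift Phi Y).

Definition phi_add Phi X Y : tensor :=
  phi_unlift Phi (phi_lift Phi X + phi_lift Phi Y).

Definition phi_exp Phi X : tensor := phi_unlift Phi (expmx (phi_lift Phi X)).

Definition phi_trace Phi X : C := \tr (phi_lift Phi X).

Definition phi_hermitian Phi X : bool := phi_lift Phi X \is hermsymmx.

Lemma phi_liftK Phi :
  Phi \in unitmx -> cancel (phi_lift Phi) (phi_unlift Phi).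
Proof.
move=> uPhi X; apply/ffunP => k; rewrite ffunE.
under eq_bigr => w _ do rewrite submxblock_diag scaler_sumr.
rewrite exchange_big /= (bigD1 k) //= [X in _ + X]big1 ?addr0 => [|l lk].
  under eq_bigr => w _ do rewrite scalerA.
  rewrite -scaler_suml.
  have /matrixP/(_ k k) := mulVmx uPhi.
  by rewrite !mxE eqxx => ->; rewrite scale1r.
under eq_bigr => w _ do rewrite scalerA.
rewrite -scaler_suml.
have /matrixP/(_ k l) := mulVmx uPhi.
by rewrite !mxE eq_sym (negPf lk) => ->; rewrite scale0r.
Qed.

Lemma phi_unliftK Phi (B : 'I_p -> 'M[C]_n) : Phi \in unitmx ->
  phi_lift Phi (phi_unlift Phi (\mxdiag_w B w)) = \mxdiag_w B w.
Proof.
move=> uPhi; apply: eq_mxdiag => w; rewrite /phi_slice.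
under eq_bigr => k _.
  rewrite ffunE; under eq_bigr => v _ do rewrite submxblock_diag.
  rewrite scaler_sumr; over.
rewrite exchange_big /= (bigD1 w) //= [X in _ + X]big1 ?addr0 => [|l lw].
  under eq_bigr => k _ do rewrite scalerA.
  rewrite -scaler_suml.
  have /matrixP/(_ w w) := mulmxV uPhi.
  by rewrite !mxE eqxx => ->; rewrite scale1r.
under eq_bigr => k _ do rewrite scalerA.
rewrite -scaler_suml.
have /matrixP/(_ w l) := mulmxV uPhi.
by rewrite !mxE eq_sym (negPf lw) => ->; rewrite scale0r.
Qed.

Lemma mul_mxdiag (B B' : 'I_p -> 'M[C]_n) :
  \mxdiag_w B w *m \mxdiag_w B' w = \mxdiag_w (B w *m B' w).
Proof.
rewrite [X in _ *m X = _]/mxdiag mul_mxdiag_mxblock; apply: eq_mxblock => i j.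
by case: eqVneq => [->|_]; rewrite ?conform_mx_id ?mulmx0.
Qed.

Lemma phi_mulE Phi X Y : Phi \in unitmx ->
  phi_lift Phi (phi_mul Phi X Y) = phi_lift Phi X *m phi_lift Phi Y.
Proof.
move=> uPhi; have MB := mul_mxdiag (phi_slice Phi X) (phi_slice Phi Y).
by rewrite /phi_mul [_ *m _]MB phi_unliftK.
Qed.

Lemma phi_addE Phi X Y : Phi \in unitmx ->
  phi_lift Phi (phi_add Phi X Y) = phi_lift Phi X + phi_lift Phi Y.
Proof.
move=> uPhi; have DB := mxdiagD (phi_slice Phi X) (phi_slice Phi Y).
by rewrite /phi_add -[_ + _]DB phi_unliftK.
Qed.

Lemma expmx_mxdiag (B : 'I_p -> 'M[C]_n) :
  exists E : 'I_p -> 'M[C]_n, expmx (\mxdiag_w B w) = \mxdiag_w E w.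
Proof.
set M := \mxdiag_w B w.
have powE (m : nat) : M ^+ m = \mxdiag_w (B w ^+ m).
  elim: m => [|m IH]; first exact/esym/mxdiagZ.
  rewrite exprS IH -[_ * _]/(_ *m _) mul_mxdiag.
  by apply: eq_mxdiag => w; rewrite exprS.
exists (fun w => submxblock (expmx M) w w).
rewrite -[LHS]submxblockK; apply: eq_mxblock => i j.
case: eqVneq => [->|ij]; first by rewrite conform_mx_id.
apply/matrixP => a b; rewrite !mxE.
set s := tagnat.Rank _ a; set t := tagnat.Rank _ b.
rewrite /expmx; set u := series _.
have u0 (m : nat) : u m s t = 0.
  rewrite /u /series /= summxE big1 // => l _.
  have : submxblock (M ^+ l) i j = 0 by rewrite powE mxblockK (negPf ij).
  by move=> /matrixP/(_ a b); rewrite !mxE -/s -/t => ->; rewrite mulr0.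
have [cu|/dvgP->] := pselect (cvgn u); last by rewrite mxE.
have : (fun m => u m s t) @ \oo --> (limn u) s t.
  exact: (cvg_comp _ _ cu (@coord_continuous _ _ _ s t (limn u))).
under eq_fun do rewrite u0.
move=> /(cvg_lim (@norm_hausdorff _ _)) <-.
exact: lim_cst.
Qed.

Lemma phi_expE Phi X : Phi \in unitmx ->
  phi_lift Phi (phi_exp Phi X) = expmx (phi_lift Phi X).
Proof.
move=> uPhi; have [E EB] := expmx_mxdiag (phi_slice Phi X).
by rewrite /phi_exp [expmx _]EB phi_unliftK.
Qed.

End PhiCalculus.

(* Main.v *)
Require Import Defs.
From mathcomp Require Import all_boot all_order all_algebra.
From mathcomp Require Import complex reals.
From mathcomp Require Import ring lra.
From mathcomp Require Import boolp classical_sets filter.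
From mathcomp Require Import topology normedtype sequences exp.

(** The lifting turns the claim into the Golden-Thompson inequality
    tr (exp (A + B)) <= tr (exp A * exp B) for the Hermitian block-diagonal
    matrices A and B lifting the two tensors.

    Golden-Thompson is the limit n = 2 ^ l -> oo of a purely algebraic
    inequality. By the Lie-Trotter formula, ((1 + A / n) * (1 + B / n)) ^+ n
    tends to exp (A + B), while (1 + A / n) ^+ n and (1 + B / n) ^+ n tend to
    exp A and exp B. The matrices P = 1 + A / n and Q = 1 + B / n are Hermitian,
    and [mxtrace_herm_pow2_le] states
      `|tr ((P * Q) ^+ n)| <= tr (P ^+ n * Q ^+ n)  for n a power of 2, n > 1.
    As tr (exp (A + B)) is nonnegative, its absolute value is itself.

    The trace inequality is proved by induction on l, together with the
    companion bound `|tr (W ^+ 2n)| <= tr ((W * W^* ) ^+ n), an instance of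
    Weyl's majorization. Each step replaces W by W ^+ 2, or P and Q by their
    squares, and uses the cyclicity of the trace; only the Cauchy-Schwarz
    inequality in its additive form 2 xy <= x ^ 2 + y ^ 2 is needed.

    The limits rest on the spectral theorem: for M = U^* D U Hermitian, both the
    partial sums of exp M and the powers (1 + M / n) ^+ n are of the form
    U^* f(D) U, so that they converge to U^* exp(D) U because they do so on
    scalars. The Lie-Trotter formula then follows by comparing
    (1 + A / n) * (1 + B / n) with 1 + (A + B) / n, which differ by
    O(1 / n ^ 2) in a submultiplicative norm ([trotter_le]). *)

Set Implicit Arguments.
Unset Strict Implicit.
Unset Printing Implicit Defensive.

Import Order.TTheory GRing.Theory Num.Theory.
Import numFieldNormedType.Exports.

Local Open Scope classical_set_scope.
Local Open Scope ring_scope.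
Local Open Scope sesquilinear_scope.

(** * Traces of powers of products of Hermitian matrices *)

Section TracePowers.
Variables (C : numClosedFieldType) (m : nat).
Implicit Types X Y P Q G H W : 'M[C]_m.

Lemma hermsymmxP X : reflect (X ^t* = X) (X \is hermsymmx).
Proof.
rewrite is_hermitianmxE expr0 scale1r eq_sym; exact: eqP.
Qed.

Lemma adjmxM X Y : (X * Y) ^t* = Y ^t* * X ^t*.
Proof. by rewrite trmx_mul map_mxM. Qed.

Lemma hermsymmxX k X : X \is hermsymmx -> X ^+ k \is hermsymmx.
Proof.
move=> /hermsymmxP hX; apply/hermsymmxP.
elim: k => [|k IH]; first by rewrite expr0 trmx1 map_mx1.
by rewrite exprS adjmxM hX IH -exprSr exprS.
Qed.

Lemma hermsymmx_mul_adj W : W * W ^t* \is hermsymmx.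
Proof. by apply/hermsymmxP; rewrite adjmxM trmxCK. Qed.

Lemma mxtrace_mulrC X Y : \tr (X * Y) = \tr (Y * X).
Proof. exact: mxtrace_mulC. Qed.

Lemma mxtrace_expMC k X Y : \tr ((X * Y) ^+ k) = \tr ((Y * X) ^+ k).
Proof.
case: k => [|k]; first by rewrite !expr0.
have comm (j : nat) : (X * Y) ^+ j * X = X * (Y * X) ^+ j.
  elim: j => [|j IH]; first by rewrite !expr0 mul1r mulr1.
  by rewrite exprS -mulrA IH !mulrA exprS !mulrA.
by rewrite exprSr mulrA comm mxtrace_mulrC mulrA -exprS.
Qed.

Lemma mxtrace_mul_adjE W : \tr (W * W ^t*) = \sum_i \sum_j `|W i j| ^+ 2.
Proof.
rewrite /mxtrace; apply: eq_bigr => i _; rewrite mxE.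
by apply: eq_bigr => j _; rewrite !mxE normCK.
Qed.

Lemma mxtrace_mul_adj_ge0 W : 0 <= \tr (W * W ^t*).
Proof.
rewrite mxtrace_mul_adjE; apply: sumr_ge0 => i _; apply: sumr_ge0 => j _.
exact: exprn_ge0.
Qed.

(** This is `|z w| <= (`|z| ^ 2 + `|w| ^ 2) / 2 summed over the pairs of
    opposite entries z = W i j and w = W j i. *)
Lemma mxtrace_sqr_le W : `|\tr (W ^+ 2)| <= \tr (W * W ^t*).
Proof.
have le_sq (a b : C) : `|a * b| *+ 2 <= `|a| ^+ 2 + `|b| ^+ 2.
  rewrite normrM -subr_ge0 addrAC -sqrrB.
  by rewrite real_exprn_even_ge0 // realB ?normr_real.
rewrite -(ler_pMn2r (isT : (0 < 2)%N)) mxtrace_mul_adjE.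
have -> : (\sum_i \sum_j `|W i j| ^+ 2) *+ 2 =
    \sum_i \sum_j (`|W i j| ^+ 2 + `|W j i| ^+ 2).
  rewrite mulr2n {2}exchange_big /= -big_split /=.
  by apply: eq_bigr => i _; rewrite -big_split.
have -> : \tr (W ^+ 2) = \sum_i \sum_j W i j * W j i.
  by apply: eq_bigr => i _; rewrite mxE.
apply: le_trans (_ : (\sum_i \sum_j `|W i j * W j i|) *+ 2 <= _).
  rewrite ler_pMn2r //; apply: le_trans (ler_norm_sum _ _ _) _.
  by apply: ler_sum => i _; apply: ler_norm_sum.
rewrite -sumrMnl; apply: ler_sum => i _; rewrite -sumrMnl.
by apply: ler_sum => j _; apply: le_sq.
Qed.

(** Nonnegativity of the trace of (P - Q) ^+ 2. *)
Lemma mxtrace_herm_mul_le P Q : P \is hermsymmx -> Q \is hermsymmx ->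
  \tr (P * Q) *+ 2 <= \tr (P ^+ 2) + \tr (Q ^+ 2).
Proof.
move=> /hermsymmxP hP /hermsymmxP hQ.
have := mxtrace_mul_adj_ge0 (P - Q).
have -> : (P - Q) ^t* = P - Q by rewrite linearB map_mxB /= hP hQ.
have -> : (P - Q) * (P - Q) = P ^+ 2 + Q ^+ 2 - (P * Q + Q * P).
  by rewrite mulrBl !mulrBr -!expr2 opprB opprD addrACA addrC addrACA.
by rewrite !(raddfB, raddfD) /= (mxtrace_mulrC Q P) -mulr2n mulNrn subr_ge0.
Qed.

(* These two families of inequalities are proved together. The second one is
   restricted to matrices of the form G * G^*, i.e. positive semidefinite ones:
   for l = 0 it asserts that tr (P * Q) >= 0, which fails for indefinite P. *)
Let weyl l := forall W,
  `|\tr (W ^+ (2 ^ l.+1))| <= \tr ((W * W ^t*) ^+ (2 ^ l)).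

Let psd_prod l := forall P Q G H, P = G * G ^t* -> Q = H * H ^t* ->
  `|\tr ((P * Q) ^+ (2 ^ l))| <= \tr (P ^+ (2 ^ l) * Q ^+ (2 ^ l)).

(* Squares of Hermitian matrices are positive semidefinite: by [weyl] for
   W = P * Q and cyclicity, the left-hand side is at most
   tr ((P ^+ 2 * Q ^+ 2) ^+ (2 ^ l)), to which [psd_prod] applies. *)
Let herm_prod l P Q : weyl l -> psd_prod l ->
    P \is hermsymmx -> Q \is hermsymmx ->
  `|\tr ((P * Q) ^+ (2 ^ l.+1))| <=
    \tr (P ^+ (2 ^ l.+1) * Q ^+ (2 ^ l.+1)).
Proof.
move=> S T /hermsymmxP hP /hermsymmxP hQ.
have PQE : \tr ((P * Q * (Q * P)) ^+ (2 ^ l)) =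
    \tr ((P ^+ 2 * Q ^+ 2) ^+ (2 ^ l)).
  by rewrite mulrA mxtrace_expMC !mulrA -mulrA -!expr2.
have := S (P * Q); rewrite adjmxM hP hQ PQE => leS.
have := T (P ^+ 2) (Q ^+ 2) P Q; rewrite hP hQ -!exprM -!expnS !expr2.
move=> /(_ erefl erefl) leT.
by apply: (le_trans leS); rewrite -[leLHS]ger0_norm // (le_trans _ leS).
Qed.

(** For the [weyl] part with V = W ^+ 2, cyclicity rewrites
    tr ((V * V^* ) ^+ (2 ^ l)) as tr ((P * Q) ^+ (2 ^ l)) where P = W^* * W and
    Q = W * W^*. By [psd_prod] this is at most tr (P ^+ (2 ^ l) * Q ^+ (2 ^ l)),
    hence at most the mean of tr (P ^+ (2 ^ l.+1)) and tr (Q ^+ (2 ^ l.+1)),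
    which are equal by cyclicity. *)
Lemma weyl_psd_prod l : weyl l /\ psd_prod l.
Proof.
elim: l => [|l [S T]].
  split=> [W|P Q G H -> ->]; first exact: mxtrace_sqr_le.
  have PQE : \tr (G * G ^t* * (H * H ^t*)) = \tr (H ^t* * G * (H ^t* * G) ^t*).
    by rewrite adjmxM trmxCK mulrA mxtrace_mulrC !mulrA.
  by rewrite !expr1 ger0_norm // PQE mxtrace_mul_adj_ge0.
split=> [W|P Q G H -> ->]; last first.
  by apply: herm_prod => //; apply: hermsymmx_mul_adj.
set P := W ^t* * W; set Q := W * W ^t*.
have hP : P \is hermsymmx by apply/hermsymmxP; rewrite adjmxM trmxCK.
have hQ : Q \is hermsymmx by apply: hermsymmx_mul_adj.
have uE : \tr ((W ^+ 2 * (W ^+ 2) ^t*) ^+ (2 ^ l)) = \tr ((P * Q) ^+ (2 ^ l)).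
  rewrite expr2 adjmxM -mulrA mxtrace_expMC.
  by rewrite (mxtrace_expMC _ P) /P /Q !mulrA.
have leS := S (W ^+ 2); rewrite uE -exprM -expnS in leS.
apply: le_trans leS _.
have := T P Q (W ^t*) W; rewrite trmxCK ger0_norm => [/(_ erefl erefl) leT|].
  2: by rewrite -uE (le_trans _ (S _)).
apply: le_trans leT _.
rewrite -(ler_pMn2r (isT : (0 < 2)%N)).
apply: le_trans (mxtrace_herm_mul_le _ _) _; try exact: hermsymmxX.
rewrite -!exprM !(mulnC (2 ^ l)%N) -!expnS (mxtrace_expMC _ (W ^t*)).
by rewrite mulr2n.
Qed.

Lemma mxtrace_herm_pow2_le l P Q : P \is hermsymmx -> Q \is hermsymmx ->
  `|\tr ((P * Q) ^+ (2 ^ l.+1))| <=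
    \tr (P ^+ (2 ^ l.+1) * Q ^+ (2 ^ l.+1)).
Proof. by have [S T] := weyl_psd_prod l; apply: herm_prod. Qed.

End TracePowers.

(** * Limits of matrices *)

Section MatrixLimits.
Variables (K : numFieldType) (T : Type) (F : set_system T).
Hypothesis FF : Filter F.

Lemma cvg_mx m n (f : T -> 'M[K]_(m, n)) (L : 'M[K]_(m, n)) :
  (forall i j, f x i j @[x --> F] --> L i j) -> f @ F --> L.
Proof.
move=> cf A [P /= PL PA].
apply: (@filterS _ F _ (fun x => forall i j, P i j (f x i j))).
  by move=> x; apply: PA.
apply: filter_forall => i; apply: filter_forall => j.
exact: cf (PL i j).
Qed.

Lemma cvg_mx_coord m n (f : T -> 'M[K]_(m, n)) (L : 'M[K]_(m, n)) i j :
  f @ F --> L -> f x i j @[x --> F] --> L i j.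
Proof.
by move=> cf; apply: (cvg_comp _ _ cf (@coord_continuous _ _ _ i j L)).
Qed.

Lemma cvg_sumr (I : Type) (r : seq I) (f : I -> T -> K) (l : I -> K) :
  (forall i, f i x @[x --> F] --> l i) ->
  \sum_(i <- r) f i x @[x --> F] --> \sum_(i <- r) l i.
Proof. by move=> cf; apply: cvg_big => //; apply: add_continuous. Qed.

Lemma cvg_mulmx m n p (f : T -> 'M[K]_(m, n)) (g : T -> 'M[K]_(n, p))
    (L : 'M[K]_(m, n)) (M : 'M[K]_(n, p)) :
  f @ F --> L -> g @ F --> M -> f x *m g x @[x --> F] --> L *m M.
Proof.
move=> cf cg; apply: cvg_mx => i j; rewrite mxE.
under eq_fun do rewrite mxE.
by apply: cvg_sumr => k; apply: cvgM; apply: cvg_mx_coord.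
Qed.

Lemma cvg_mxtrace m (f : T -> 'M[K]_m) (L : 'M[K]_m) :
  f @ F --> L -> \tr (f x) @[x --> F] --> \tr L.
Proof. by move=> cf; apply: cvg_sumr => i; apply: cvg_mx_coord. Qed.

End MatrixLimits.

(** The order need not be total. The differences v n - u n are equal to their
    norms; hence so is their limit, which is thus nonnegative. *)
Lemma ler_cvgn (K : numFieldType) (u v : K ^nat) (a b : K) :
  (forall n, u n <= v n) -> u @ \oo --> a -> v @ \oo --> b -> a <= b.
Proof.
move=> uv ua vb; rewrite -subr_ge0.
have cw : v n - u n @[n --> \oo] --> b - a by apply: cvgB.
suff -> : b - a = `|b - a| by apply: normr_ge0.
apply: (cvg_unique (@norm_hausdorff _ _) cw).
have -> : (fun n => v n - u n) = (fun n => `|v n - u n|).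
  by apply/funext => n; rewrite ger0_norm ?subr_ge0.
exact: cvg_norm.
Qed.

(** * A submultiplicative norm and the Trotter error *)

Section L1Norm.
Variables (K : numFieldType) (m : nat).
Implicit Types X Y : 'M[K]_m.

(** The sum of the moduli of the entries is submultiplicative, unlike their
    maximum, which is the norm carried by the type of matrices. *)
Definition l1norm X : K := \sum_i \sum_j `|X i j|.

Lemma l1norm_ge0 X : 0 <= l1norm X.
Proof. by apply: sumr_ge0 => i _; apply: sumr_ge0. Qed.

Lemma l1normD X Y : l1norm (X + Y) <= l1norm X + l1norm Y.
Proof.
rewrite -big_split /=; apply: ler_sum => i _; rewrite -big_split /=.
by apply: ler_sum => j _; rewrite mxE ler_normD.
Qed.

Lemma l1normZ a X : l1norm (a *: X) = `|a| * l1norm X.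
Proof.
rewrite /l1norm mulr_sumr; apply: eq_bigr => i _; rewrite mulr_sumr.
by apply: eq_bigr => j _; rewrite mxE normrM.
Qed.

Lemma norm_le_l1norm X i j : `|X i j| <= l1norm X.
Proof.
rewrite /l1norm (bigD1 i) //= (bigD1 j) //= -addrA lerDl addr_ge0 //.
  exact: sumr_ge0.
by apply: sumr_ge0 => k _; apply: sumr_ge0.
Qed.

Lemma l1normM X Y : l1norm (X * Y) <= l1norm X * l1norm Y.
Proof.
rewrite /l1norm mulr_suml; apply: ler_sum => i _.
apply: le_trans (_ : \sum_j \sum_k `|X i k| * `|Y k j| <= _).
  apply: ler_sum => j _; rewrite mxE; apply: le_trans (ler_norm_sum _ _ _) _.
  by apply: ler_sum => k _; rewrite normrM.
rewrite exchange_big mulr_suml /=; apply: ler_sum => k _.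
rewrite -mulr_sumr ler_wpM2l // [leRHS](bigD1 k) //= lerDl.
by apply: sumr_ge0 => l _; apply: sumr_ge0.
Qed.

(** The norm of 1 is the size of the matrix. Powers are therefore estimated one
    factor at a time, through the distance of the factor to 1: a bound by powers
    of the norm would grow like a power of the size. *)
Lemma l1norm_near1M e X Y :
  l1norm (X - 1) <= e -> l1norm (X * Y) <= (1 + e) * l1norm Y.
Proof.
move=> Xe; rewrite -[X](subrK 1) addrC mulrDl mul1r.
apply: le_trans (l1normD _ _) _; rewrite [leRHS]mulrDl mul1r lerD2l.
by apply: le_trans (l1normM _ _) _; rewrite ler_wpM2r // l1norm_ge0.
Qed.

Lemma l1normM_near1 e X Y :
  l1norm (Y - 1) <= e -> l1norm (X * Y) <= (1 + e) * l1norm X.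
Proof.
move=> Ye; rewrite -[Y](subrK 1) addrC mulrDr mulr1.
apply: le_trans (l1normD _ _) _; rewrite [leRHS]mulrDl mul1r lerD2l mulrC.
by apply: le_trans (l1normM _ _) _; rewrite ler_wpM2l // l1norm_ge0.
Qed.

(** Telescoping: X ^+ k - Y ^+ k is the sum of the k terms
    X ^+ (k - 1 - j) * (X - Y) * Y ^+ j. *)
Lemma l1normB_exp e X Y k : l1norm (X - 1) <= e -> l1norm (Y - 1) <= e ->
  l1norm (X ^+ k - Y ^+ k) <= ((1 + e) ^+ k * l1norm (X - Y)) *+ k.
Proof.
move=> Xe Ye; have e0 : 0 <= e by apply: le_trans Xe; apply: l1norm_ge0.
have e1 : 0 <= 1 + e by rewrite addr_ge0.
have bound (j : nat) :
    l1norm ((X - Y) * Y ^+ j) <= (1 + e) ^+ j * l1norm (X - Y).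
  elim: j => [|j IH]; first by rewrite !expr0 mulr1 mul1r.
  rewrite (exprSr Y) mulrA (exprS (1 + e)) -(mulrA (1 + e)).
  by apply: le_trans (l1normM_near1 _ Ye) _; rewrite ler_wpM2l.
elim: k => [|k IH].
  rewrite !expr0 subrr mulr0n /l1norm big1 // => i _; rewrite big1 // => j _.
  by rewrite mxE normr0.
have -> : X ^+ k.+1 - Y ^+ k.+1 = X * (X ^+ k - Y ^+ k) + (X - Y) * Y ^+ k.
  by rewrite !exprS mulrBr mulrBl addrA subrK.
apply: le_trans (l1normD _ _) _; rewrite mulrSr lerD //.
  apply: le_trans (l1norm_near1M _ Xe) _.
  by rewrite exprS -mulrA -mulrnAr ler_wpM2l.
apply: le_trans (bound k) _; rewrite exprS -mulrA ler_peMl ?lerDl //.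
by rewrite mulr_ge0 ?exprn_ge0 ?l1norm_ge0.
Qed.

(** The first factor bounds the growth of n-fold products of matrices at
    distance O(1 / n) from 1; it converges to an exponential, while the second
    factor tends to 0. *)
Definition trotter_bound X Y n : K :=
  (1 + n%:R^-1 * (l1norm X + l1norm Y + l1norm X * l1norm Y)) ^+ n *
    (n%:R^-1 * (l1norm X * l1norm Y)).

Lemma trotter_bound_ge0 X Y n : 0 <= trotter_bound X Y n.
Proof.
by rewrite !(mulr_ge0, exprn_ge0, addr_ge0, invr_ge0, l1norm_ge0, ler0n, ler01).
Qed.

(** The two bases differ by X * Y / n ^ 2, and the telescoping sum has n terms
    of that order. *)
Lemma trotter_le X Y n :
  l1norm (((1 + n%:R^-1 *: X) * (1 + n%:R^-1 *: Y)) ^+ n -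
      (1 + n%:R^-1 *: (X + Y)) ^+ n) <= trotter_bound X Y n.
Proof.
rewrite /trotter_bound.
set a := l1norm X; set b := l1norm Y; set t := n%:R^-1.
have a0 : 0 <= a by apply: l1norm_ge0.
have b0 : 0 <= b by apply: l1norm_ge0.
have ab0 : 0 <= a * b by apply: mulr_ge0.
set c := a + b + a * b; have c0 : 0 <= c by rewrite !addr_ge0.
have t0 : 0 <= t by rewrite invr_ge0.
(* For n = 0 this holds because the inverse of 0 is 0. *)
have t1 : t <= 1.
  by rewrite /t; case: (n) => [|k]; rewrite ?invr0 ?ler01 // invf_le1 ?ler1n.
set P := (_ * _ : 'M_m); set Q := 1 + t *: (X + Y).
have PE : P = Q + (t * t) *: (X * Y).
  rewrite /P /Q mulrDl !mulrDr !mul1r !mulr1 -[t *: X * _]/(_ *m _).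
  by rewrite -scalemxAl -scalemxAr scalerA scalerDr !addrA (addrAC 1).
have XY_le : l1norm (X * Y) <= a * b by apply: l1normM.
have P1 : l1norm (P - 1) <= t * c.
  have -> : P - 1 = t *: (X + Y + t *: (X * Y)).
    rewrite PE /Q [in RHS]scalerDr scalerA.
    by rewrite addrAC [1 + _]addrC addrK.
  rewrite l1normZ ger0_norm // ler_wpM2l //; apply: le_trans (l1normD _ _) _.
  rewrite lerD ?l1normD // l1normZ ger0_norm //.
  by apply: le_trans XY_le; rewrite ler_piMl ?l1norm_ge0.
have Q1 : l1norm (Q - 1) <= t * c.
  rewrite /Q addrAC subrr add0r l1normZ ger0_norm // ler_wpM2l //.
  by apply: le_trans (l1normD _ _) _; rewrite lerDl.
have PQ : l1norm (P - Q) <= t * t * (a * b).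
  by rewrite PE addrC addKr l1normZ ger0_norm ?mulr_ge0 // ler_wpM2l ?mulr_ge0.
apply: le_trans (l1normB_exp _ P1 Q1) _; rewrite -mulrnAr.
rewrite ler_wpM2l ?exprn_ge0 ?addr_ge0 ?mulr_ge0 //.
apply: le_trans (_ : (t * t * (a * b)) *+ n <= _).
  by rewrite lerMn2r PQ orbT.
rewrite /t; case: (n) => [|k]; first by rewrite mulr0n invr0 mul0r.
by rewrite -mulrA -mulrnAl -[_ *+ k.+1]mulr_natr mulVf ?mul1r // pnatr_eq0.
Qed.

End L1Norm.

(** * Scalar exponentials *)

Lemma cvg_natV (R : realType) : (n%:R^-1 : R) @[n --> \oo] --> (0 : R).
Proof.
by rewrite -(cvg_shiftS (fun n => n%:R^-1 : R)); apply: cvg_harmonic.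
Qed.

(** With x = a / n, the upper bound is (1 + x) ^ n <= exp(x) ^ n = exp(a). For
    the lower bound, (1 - x) ^ n <= exp(- a) and Bernoulli's inequality give
    (1 + x) ^ n * exp(- a) >= (1 - x ^ 2) ^ n >= 1 - n * x ^ 2, that is
    1 - a ^ 2 / n. *)
Lemma expR_cvgn (R : realType) (a : R) :
  (1 + n%:R^-1 * a) ^+ n @[n --> \oo] --> expR a.
Proof.
have bern (x : R) n : 0 <= x <= 1 -> 1 - n%:R * x <= (1 - x) ^+ n.
  move=> /andP[x0 x1]; elim: n => [|n IH]; first by rewrite mul0r subr0 expr0.
  rewrite exprS.
  apply: le_trans (_ : (1 - x) * (1 - n%:R * x) <= _); last first.
    by rewrite ler_wpM2l // subr_ge0.
  have : 0 <= n%:R * x * x by rewrite !mulr_ge0.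
  rewrite -natr1; nra.
apply: (@squeeze_cvgr _ _ _ _ (fun n => expR a * (1 - n%:R^-1 * a ^+ 2))
          (fun=> expR a)); last exact: cvg_cst.
- near=> n.
  have an : `|a| < n%:R by near: n; apply: nbhs_infty_gtr.
  have n0 : 0 < n%:R :> R by apply: le_lt_trans an.
  have {an} : `|n%:R^-1 * a| <= 1.
    by rewrite normrM gtr0_norm ?invr_gt0 // ler_pdivrMl // mulr1 ltW.
  set x := n%:R^-1 * a; rewrite ler_norml => /andP[x1 x2].
  have expE (b : R) : expR (n%:R^-1 * b) ^+ n = expR b.
    by rewrite -expRM_natl mulVKf // gt_eqF.
  apply/andP; split; last first.
    by rewrite -[leRHS]expE lerXn2r ?nnegrE ?expR_ge0 ?expR_ge1Dx //; lra.
  have x3 : n%:R^-1 * a ^+ 2 = n%:R * x ^+ 2.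
    by rewrite /x; field; rewrite gt_eqF.
  have x4 : 0 <= x ^+ 2 <= 1 by apply/andP; split; nra.
  have -> : (1 + x) ^+ n = expR a * (expR (- a) * (1 + x) ^+ n).
    by rewrite mulrA expRxMexpNx_1 mul1r.
  rewrite x3 ler_wpM2l ?expR_ge0 //.
  apply: le_trans (bern _ n x4) _.
  have -> : 1 - x ^+ 2 = (1 - x) * (1 + x) by ring.
  rewrite exprMn ler_wpM2r ?exprn_ge0 //; first by lra.
  rewrite -(expE (- a)) lerXn2r ?nnegrE ?expR_ge0 //; first by lra.
  by rewrite mulrN expR_ge1Dx.
- have : expR a * (1 - n%:R^-1 * a ^+ 2) @[n --> \oo] -->
      expR a * (1 - 0 * a ^+ 2).
    apply: cvgM; first exact: cvg_cst.
    apply: cvgB; first exact: cvg_cst.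
    by apply: cvgM; [exact: cvg_natV | exact: cvg_cst].
  by rewrite mul0r subr0 mulr1.
Unshelve. all: by end_near. Qed.

(** * Functional calculus of Hermitian matrices *)

Section SpectralCalculus.
Variables (C : numClosedFieldType) (m : nat).
Implicit Types (U M : 'M[C]_m) (d e : 'I_m -> C).

(** This is f(M) when M = U^* D U and d lists the values of f on the diagonal
    of D. *)
Definition spectral_fun U d : 'M[C]_m := U ^t* *m diag_mx (\row_i d i) *m U.

Lemma eq_spectral_fun U d e : d =1 e -> spectral_fun U d = spectral_fun U e.
Proof. by move=> /funext->. Qed.

Lemma hermsymmx_spectral M : M \is hermsymmx ->
  exists2 U, U \is unitarymx &
    exists2 d, (forall i, d i \is Num.real) & M = spectral_fun U d.
Proof.
move=> hM; exists (spectralmx M); first exact: spectral_unitarymx.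
exists (fun i => spectral_diag M 0 i) => [i|].
  by have /mxOverP := hermitian_spectral_diag_real hM; apply.
have /hermitian_normalmx/orthomx_spectralP {1}-> := hM.
rewrite invmx_unitary ?spectral_unitarymx // /spectral_fun.
by congr (_ *m diag_mx _ *m _); apply/rowP => i; rewrite mxE.
Qed.

Lemma spectral_funD U d e :
  spectral_fun U d + spectral_fun U e = spectral_fun U (fun i => d i + e i).
Proof.
rewrite /spectral_fun -mulmxDl -mulmxDr -raddfD; congr (_ *m diag_mx _ *m _).
by apply/rowP => i; rewrite !mxE.
Qed.

Lemma spectral_funZ U c d :
  c *: spectral_fun U d = spectral_fun U (fun i => c * d i).
Proof.
rewrite /spectral_fun scalemxAl scalemxAr -linearZ; congr (_ *m diag_mx _ *m _).
by apply/rowP => i; rewrite !mxE.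
Qed.

Lemma cvg_spectral_fun U (d : nat -> 'I_m -> C) e :
  (forall i, d n i @[n --> \oo] --> e i) ->
  spectral_fun U (d n) @[n --> \oo] --> spectral_fun U e.
Proof.
move=> cd; apply: cvg_mulmx; last exact: cvg_cst.
apply: cvg_mulmx; first exact: cvg_cst.
apply: cvg_mx => i j; rewrite !mxE; under eq_fun do rewrite !mxE.
exact: cvgMn.
Qed.

Variable U : 'M[C]_m.
Hypothesis uU : U \is unitarymx.

Lemma spectral_fun1 : spectral_fun U (fun=> 1) = 1.
Proof.
have -> : spectral_fun U (fun=> 1) = U ^t* *m 1%:M *m U.
  rewrite /spectral_fun; congr (_ *m _ *m _).
  by apply/matrixP => i j; rewrite !mxE.
by rewrite mulmx1 -invmx_unitary // mulVmx // unitarymx_unit.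
Qed.

Lemma spectral_funM d e :
  spectral_fun U d * spectral_fun U e = spectral_fun U (fun i => d i * e i).
Proof.
rewrite /spectral_fun -[_ * _]/(_ *m _) !mulmxA mulmxtVK // -!mulmxA.
congr (_ *m _); rewrite !mulmxA mulmx_diag; congr (diag_mx _ *m _).
by apply/rowP => i; rewrite !mxE.
Qed.

Lemma spectral_funX d k :
  spectral_fun U d ^+ k = spectral_fun U (fun i => d i ^+ k).
Proof.
elim: k => [|k IH]; first by rewrite expr0 spectral_fun1.
by rewrite exprS IH spectral_funM; apply: eq_spectral_fun => i; rewrite exprS.
Qed.

Lemma mxtrace_spectral_fun d : \tr (spectral_fun U d) = \sum_i d i.
Proof.
rewrite /spectral_fun mxtrace_mulC mulmxA (unitarymxP uU) mul1mx mxtrace_diag.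
by apply: eq_bigr => i _; rewrite mxE.
Qed.

(** The partial sums of the exponential series are themselves values of the
    functional calculus, so that only scalar series have to converge. *)
Lemma expmx_spectral_fun d e :
  (forall i, series (fun k => (k`!%:R)^-1 * d i ^+ k) @ \oo --> e i) ->
  expmx (spectral_fun U d) = spectral_fun U e.
Proof.
move=> de; rewrite /expmx.
have -> : series (fun k => (k`!%:R)^-1 *: spectral_fun U d ^+ k) =
    fun n => spectral_fun U (fun i =>
      series (fun k => (k`!%:R)^-1 * d i ^+ k) n).
  apply/funext; elim=> [|n IH].
    rewrite [LHS]big_geq // -[LHS](scale0r (spectral_fun U d)) spectral_funZ.
    by apply: eq_spectral_fun => i; rewrite mul0r [RHS]big_geq.
  rewrite seriesSr IH spectral_funX spectral_funZ spectral_funD.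
  by apply: eq_spectral_fun => i; rewrite seriesSr.
by apply: (cvg_lim (@norm_hausdorff _ _)); apply: cvg_spectral_fun.
Qed.

End SpectralCalculus.

(** * The Golden-Thompson inequality *)

(** The two classical limits defining the exponential, for real scalars. The
    matrix statements below depend on the scalars only through them and through
    the convergence of 1 / n to 0. *)
Definition real_exp_limits (C : numClosedFieldType) :=
  forall x : C, x \is Num.real -> exists e : C,
    [/\ 0 <= e, series (fun k => (k`!%:R)^-1 * x ^+ k) @ \oo --> e
      & (1 + n%:R^-1 * x) ^+ n @[n --> \oo] --> e].

Section GoldenThompson.
Variables (C : numClosedFieldType) (m : nat).
Hypothesis expC : real_exp_limits C.
Hypothesis cvgV : (n%:R^-1 : C) @[n --> \oo] --> (0 : C).
Implicit Types (M A B : 'M[C]_m).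

(** Both facts come from the diagonalization of M: the eigenvalues of exp M are
    exponentials of real numbers. *)
Lemma expmx_herm M : M \is hermsymmx ->
  0 <= \tr (expmx M) /\ (1 + n%:R^-1 *: M) ^+ n @[n --> \oo] --> expmx M.
Proof.
move=> /hermsymmx_spectral[U uU [d dR ->]].
have /choice[e he] : forall i, exists e : C, [/\ 0 <= e,
    series (fun k => (k`!%:R)^-1 * d i ^+ k) @ \oo --> e
    & (1 + n%:R^-1 * d i) ^+ n @[n --> \oo] --> e].
  by move=> i; apply: expC.
rewrite (expmx_spectral_fun uU (e := e)) => [|i]; last by have [] := he i.
split.
  by rewrite mxtrace_spectral_fun //; apply: sumr_ge0 => i _; have [] := he i.
rewrite (_ : (fun n => _) =
    fun n => spectral_fun U (fun i => (1 + n%:R^-1 * d i) ^+ n)).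
  by apply: cvg_spectral_fun => i; have [] := he i.
apply/funext => n.
by rewrite spectral_funZ -(spectral_fun1 uU) spectral_funD spectral_funX.
Qed.

Lemma hermsymmxD A B :
  A \is hermsymmx -> B \is hermsymmx -> A + B \is hermsymmx.
Proof.
move=> /hermsymmxP hA /hermsymmxP hB; apply/hermsymmxP.
by rewrite linearD map_mxD /= hA hB.
Qed.

Lemma trotter_bound_cvg A B :
  trotter_bound A B n @[n --> \oo] --> (0 : C).
Proof.
set c := l1norm A + l1norm B + l1norm A * l1norm B.
have /expC[e [_ _ ce]] : c \is Num.real.
  by rewrite ger0_real // !addr_ge0 ?mulr_ge0 ?l1norm_ge0.
have : (1 + n%:R^-1 * c) ^+ n * (n%:R^-1 * (l1norm A * l1norm B)) @[n --> \oo]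
    --> e * (0 * (l1norm A * l1norm B)).
  by apply: cvgM => //; apply: cvgM; [exact: cvgV | exact: cvg_cst].
by rewrite mul0r mulr0.
Qed.

Lemma lie_trotter A B : A \is hermsymmx -> B \is hermsymmx ->
  ((1 + n%:R^-1 *: A) * (1 + n%:R^-1 *: B)) ^+ n @[n --> \oo] -->
    expmx (A + B).
Proof.
move=> hA hB; have [_ cAB] := expmx_herm (hermsymmxD hA hB).
pose X n := (1 + n%:R^-1 *: A) * (1 + n%:R^-1 *: B).
pose Y n := 1 + n%:R^-1 *: (A + B).
suff cXY : X n ^+ n - Y n ^+ n @[n --> \oo] --> (0 : 'M[C]_m).
  rewrite -[expmx _]add0r.
  rewrite (_ : (fun n => _) = fun n => X n ^+ n - Y n ^+ n + Y n ^+ n).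
    exact: cvgD cXY cAB.
  by apply/funext => n; rewrite subrK.
apply: cvg_mx => i j; rewrite mxE; apply/cvgr0Pnorm_le => e e0.
have /cvgr0Pnorm_le/(_ e e0) := trotter_bound_cvg A B.
apply: filterS => n; apply: le_trans.
apply: le_trans (norm_le_l1norm _ i j) _; apply: le_trans (trotter_le A B n) _.
by rewrite ger0_norm // trotter_bound_ge0.
Qed.

(** Limit of [mxtrace_herm_pow2_le] along the exponents 2 ^ l.+1. *)
Lemma golden_thompson A B : A \is hermsymmx -> B \is hermsymmx ->
  \tr (expmx (A + B)) <= \tr (expmx A *m expmx B).
Proof.
move=> hA hB; have [tr0 _] := expmx_herm (hermsymmxD hA hB).
rewrite -[leLHS]ger0_norm //.
have cpow : (2 ^ n.+1)%N @[n --> \oo] --> \oo.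
  apply/cvgnyPge => N; near=> n.
  apply: leq_trans (ltnW (ltn_expl n.+1 (isT : (1 < 2)%N))).
  by apply: leqW; near: n; apply: nbhs_infty_ge.
have h1 M n : M \is hermsymmx -> 1 + n%:R^-1 *: M \is hermsymmx.
  move=> hM; apply: hermsymmxD; first exact: (hermsymmxX 0 hM).
  apply/hermsymmxP; rewrite linearZ map_mxZ /= (hermsymmxP _ hM).
  by rewrite conj_Creal // ger0_real // invr_ge0.
apply: ler_cvgn; last first.
- apply: cvg_mxtrace; apply: cvg_mulmx.
    exact: cvg_comp cpow (expmx_herm hA).2.
  exact: cvg_comp cpow (expmx_herm hB).2.
- apply: cvg_norm; apply: cvg_mxtrace.
  exact: cvg_comp cpow (lie_trotter hA hB).
- by move=> n /=; apply: mxtrace_herm_pow2_le; apply: h1.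
Unshelve. all: by end_near. Qed.

End GoldenThompson.

Lemma phi_golden_thompson (C : numClosedFieldType) (n p : nat) (Phi : 'M[C]_p)
    (A B : tensor C n p) :
  real_exp_limits C -> (n%:R^-1 : C) @[n --> \oo] --> (0 : C) ->
  Phi \in unitmx -> phi_hermitian Phi A -> phi_hermitian Phi B ->
  phi_trace Phi (phi_exp Phi (phi_add Phi A B)) <=
    phi_trace Phi (phi_mul Phi (phi_exp Phi A) (phi_exp Phi B)).
Proof.
move=> expC cvgV uPhi hA hB.
rewrite /phi_trace phi_mulE // !phi_expE // phi_addE //.
exact: golden_thompson.
Qed.

(** * Complex numbers over the reals *)

Section ComplexScalars.
Variable R : realType.
Let C : numClosedFieldType := R[i].

Lemma cvg_real_complex (T : Type) (F : set_system T) (FF : Filter F)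
    (u : T -> R) (l : R) :
  u @ F --> l -> ((u x)%:C%C : C) @[x --> F] --> (l%:C%C : C).
Proof.
move=> /cvgrPdist_le cu; apply/cvgrPdist_le => e e0.
have eE : (complex.Re e)%:C%C = e by rewrite RRe_real ?gtr0_real.
have := cu (complex.Re e); rewrite -ltcR eE => /(_ e0).
apply: filterS => x; rewrite -lecR eE -rmorphB normc_def /=.
by rewrite expr0n addr0 sqrtr_sqr.
Qed.

Lemma natV_real_complex n : (n%:R^-1 : C) = (n%:R^-1 : R)%:C%C.
Proof. by rewrite fmorphV rmorph_nat. Qed.

Lemma cvg_natV_complex : (n%:R^-1 : C) @[n --> \oo] --> (0 : C).
Proof.
rewrite (_ : (fun n => _) = fun n => (n%:R^-1 : R)%:C%C).
  by apply: cvg_real_complex; apply: cvg_natV.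
by apply/funext => n; apply: natV_real_complex.
Qed.

Lemma complex_real_exp_limits : real_exp_limits C.
Proof.
move=> _ /complex_realP[x ->]; exists (expR x)%:C%C; split.
- by rewrite ler0c expR_ge0.
- rewrite (_ : series _ = fun n => (series (exp_coeff x) n)%:C%C).
    by apply: cvg_real_complex; apply: is_cvg_series_exp_coeff.
  apply/funext => n; rewrite /series /= rmorph_sum; apply: eq_bigr => k _.
  by rewrite /exp_coeff /= natV_real_complex mulrC rmorphM rmorphXn.
- rewrite (_ : (fun n => _) = fun n => ((1 + n%:R^-1 * x) ^+ n)%:C%C).
    by apply: cvg_real_complex; apply: expR_cvgn.
  apply/funext => n.
  by rewrite natV_real_complex rmorphXn rmorphD rmorph1 rmorphM.
Qed.

End ComplexScalars.

(* The order on R[i] is the usual partial one: x <= y means that y - x is a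
   nonnegative real number. *)
Theorem theorem1 (R : realType) (n p : nat) (n_gt0 : (0 < n)%N)
    (p_gt0 : (0 < p)%N) (Phi : 'M[R[i]]_p) (Phi_unitary : Phi \is unitarymx)
    (A B : tensor R[i] n p) (A_herm : phi_hermitian Phi A)
    (B_herm : phi_hermitian Phi B) :
  phi_trace Phi (phi_exp Phi (phi_add Phi A B)) <=
    phi_trace Phi (phi_mul Phi (phi_exp Phi A) (phi_exp Phi B)).
Proof.
have uPhi := unitarymx_unit Phi_unitary.
have H := @phi_golden_thompson _ n p Phi A B (@complex_real_exp_limits R)
  (@cvg_natV_complex R) uPhi A_herm B_herm.
exact H.
Qed.
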